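(* For every partition $\lambda\vdash n$ and every $j\in\{0,\dots,n-1\}$, the map $\phi:\mathrm{Com}_{\lambda,j}\to\mathfrak R_{\lambda,j}$ is a well-defined bijection.
   Context: Let $\mathcal A=\{1,\bar1,2,\bar2,3,\bar3,\dots\}$; the absolute value $|a|$ of a letter is obtained by removing the bar. A circular word is a word read around a circle clockwise; it is primitive if the linear words obtained by reading it clockwise from each of its starting positions are all distinct. A (bicolored) necklace is a primitive circular word over $\mathcal A$ such that, if its length exceeds $1$, every barred letter is followed clockwise by a letter of absolute value at most its own, and every unbarred letter is followed clockwise by a letter of absolute value at least its own; a circular word of length $1$ is a necklace iff its letter is unbarred. An ornament is a finite multiset of necklaces; its type is the partition formed by the lengths of its necklaces. $\mathfrak R_{\lambda,j}$ is the set of ornaments of type $\lambda$ with exactly $j$ barred letters in total. For $\sigma\in\mathfrak S_n$ (one-line notation), $\mathrm{Exc}(\sigma)=\{i\in[n-1]:\sigma_i>i\}$; order $\bar1<\dots<\bar n<1<\dots<n$, let $\bar\sigma$ be $\sigma$ with $\sigma_i$ barred for $i\in\mathrm{Exc}(\sigma)$, and $\mathrm{Exd}(\sigma)=\{i\in[n-1]:\bar\sigma_i>\bar\sigma_{i+1}\}$. A sequence $s_1\ge s_2\ge\dots\ge s_n$ of positive integers is $\sigma$-compatible if $s_i>s_{i+1}$ whenever $i\in\mathrm{Exd}(\sigma)$. $\mathrm{Com}_{\lambda,j}$ is the set of pairs $(\sigma,s)$ with $\sigma\in\mathfrak S_n$ of cycle type $\lambda$ and with $|\mathrm{Exc}(\sigma)|=j$,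 and $s$ a $\sigma$-compatible sequence. $\phi(\sigma,s)$ is obtained by writing $\sigma$ in cycle form, placing a bar over every letter $i$ with $\sigma(i)>i$ (i.e. each letter followed cyclically by a larger letter), and then replacing each letter $i$ by $s_i$, keeping the bars; each cycle becomes a circular word and $\phi(\sigma,s)$ is the resulting multiset of circular words. *)

(* Defs.v *)
From mathcomp Require Import all_boot perm.
From mathcomp Require Import finmap multiset.
From mathcomp Require Import classical_sets functions.

Set Implicit Arguments.
Unset Strict Implicit.
Unset Printing Implicit Defensive.

Local Open Scope nat_scope.
Local Open Scope quotient_scope.
Local Open Scope mset_scope.

Definition is_partition (n : nat) (lam : seq nat) : bool :=
  [&& sorted geq lam, all (leq 1) lam & sumn lam == n].

(* A letter is (absolute value, is it barred?); the alphabet consists of the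
   pairs with positive first component, see [is_necklace_word]. *)
Definition letter : Type := (nat * bool)%type.

(* The order in which every barred letter precedes every unbarred letter. *)
Definition ltr_lt (a b : letter) : bool :=
  (a.2 && ~~ b.2) || ((a.2 == b.2) && (a.1 < b.1)).

(* Circular words are linear words up to rotation. *)
Definition rot_eq (u v : seq letter) : bool :=
  v \in [seq rot i u | i <- iota 0 (size u).+1].

Lemma rot_eqP u v : reflect (exists i, v = rot i u) (rot_eq u v).
Proof.
apply: (iffP mapP) => [[i _ ->]|[i ->]]; first by exists i.
have [le_iu|lt_ui] := leqP i (size u).
  by exists i; rewrite // mem_iota.
by exists 0; rewrite ?mem_iota // rot0 rot_oversize // ltnW.
Qed.

Lemma rot_eq_refl : reflexive rot_eq.
Proof. by move=> u; apply/rot_eqP; exists 0; rewrite rot0. Qed.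

Lemma rot_eq_sym : symmetric rot_eq.
Proof.
suff H u v : rot_eq u v -> rot_eq v u by move=> u v; apply/idP/idP; apply: H.
case/rot_eqP=> i ->; apply/rot_eqP; exists (size (rot i u) - i).
by rewrite -[RHS]/(rotr i (rot i u)) rotK.
Qed.

Lemma rot_eq_trans : transitive rot_eq.
Proof.
move=> v u w /rot_eqP[i ->] /rot_eqP[j ->]; apply/rot_eqP.
have [le_iu|/ltnW lt_ui] := leqP i (size u); last first.
  by exists j; rewrite (rot_oversize lt_ui).
have [le_ju|/ltnW lt_uj] := leqP j (size u); last first.
  by exists i; rewrite [LHS]rot_oversize ?size_rot.
by rewrite rot_add_mod //; eexists.
Qed.

Canonical rot_equiv :=
  EquivRel rot_eq rot_eq_refl rot_eq_sym rot_eq_trans.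

Definition cword := {eq_quot rot_equiv}.

Definition cword_of (u : seq letter) : cword := \pi_cword u.

Lemma cword_ofP u v : reflect (exists i, v = rot i u) (cword_of u == cword_of v).
Proof. by apply: (iffP idP); rewrite /cword_of eqmodE => /rot_eqP. Qed.

Definition primitive_word (u : seq letter) : bool :=
  uniq [seq rot i u | i <- iota 0 (size u)].

(* [step_ok a b]: the letter a may be followed clockwise by the letter b. *)
Definition step_ok (a b : letter) : bool :=
  if a.2 then b.1 <= a.1 else a.1 <= b.1.

Definition is_necklace_word (u : seq letter) : bool :=
  [&& 0 < size u, all (fun a : letter => 0 < a.1) u, primitive_word u
    & if size u == 1 then all (fun a : letter => ~~ a.2) u
      else cycle step_ok u].

Definition nbars (u : seq letter) : nat := count (fun a : letter => a.2) u.

(* Notions on circular words are read off a representative; [cw_size_of],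
   [cw_bars_of] and [is_necklace_of] state that its choice is immaterial. *)
Definition cw_size (w : cword) : nat := size (repr w).
Definition cw_bars (w : cword) : nat := nbars (repr w).
Definition is_necklace (w : cword) : bool := is_necklace_word (repr w).

Lemma repr_cword_of u : exists i, repr (cword_of u) = rot i u.
Proof. by apply/cword_ofP; rewrite /cword_of reprK. Qed.

Lemma cw_size_of u : cw_size (cword_of u) = size u.
Proof. by rewrite /cw_size; have [i ->] := repr_cword_of u; rewrite size_rot. Qed.

Lemma cw_bars_of u : cw_bars (cword_of u) = nbars u.
Proof.
rewrite /cw_bars; have [i ->] := repr_cword_of u.
by rewrite /nbars /rot count_cat addnC -count_cat cat_take_drop.
Qed.

Lemma primitive_word_rot i u : primitive_word (rot i u) = primitive_word u.
Proof.
rewrite /primitive_word size_rot -[RHS](map_inj_uniq (@rot_inj i _)) -map_comp.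
by congr (uniq _); apply: eq_map => k /=; rewrite rot_rot.
Qed.

Lemma is_necklace_of u : is_necklace (cword_of u) = is_necklace_word u.
Proof.
rewrite /is_necklace; have [i ->] := repr_cword_of u.
rewrite /is_necklace_word size_rot primitive_word_rot rot_cycle.
by rewrite !(eq_all_r (mem_rot i u)).
Qed.

Definition ornament_type (o : {mset cword}) : seq nat :=
  sort geq [seq cw_size w | w <- o].

Definition Orn (lam : seq nat) (j : nat) : set {mset cword} :=
  [set o : {mset cword} | [/\ forall w, w \in o -> is_necklace w,
      ornament_type o = lam
    & sumn [seq cw_bars w | w <- o] = j]].

(* Permutations act on 'I_n = {0, ..., n-1}: the ordinal i stands for the
   integer i + 1, so [i.+1 < n] encodes membership in [n-1]. *)
Definition Exc n (sigma : 'S_n) : {set 'I_n} :=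
  [set i : 'I_n | (i.+1 < n) && (i < sigma i)].

Definition bar_perm n (sigma : 'S_n) (i : 'I_n) : letter :=
  ((sigma i).+1, i \in Exc sigma).

Definition Exd n (sigma : 'S_n) : {set 'I_n} :=
  [set i : 'I_n | [exists k : 'I_n, (k == i.+1 :> nat)
                     && ltr_lt (bar_perm sigma k) (bar_perm sigma i)]].

Definition compatible n (sigma : 'S_n) (s : n.-tuple nat) : Prop :=
  [/\ forall i : 'I_n, 0 < tnth s i,
      forall i k : 'I_n, k = i.+1 :> nat -> tnth s k <= tnth s i
    & forall i k : 'I_n, k = i.+1 :> nat -> i \in Exd sigma ->
        tnth s k < tnth s i].

(* The cycles x, sigma x, sigma (sigma x), ..., one per orbit of sigma. *)
Definition cycle_form n (sigma : 'S_n) : seq (seq 'I_n) :=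
  [seq orbit sigma x | x <- enum (froots sigma)].

Definition cycle_type n (sigma : 'S_n) : seq nat :=
  sort geq (shape (cycle_form sigma)).

Definition Com n (lam : seq nat) (j : nat) : set ('S_n * n.-tuple nat) :=
  [set p : 'S_n * n.-tuple nat | [/\ cycle_type p.1 = lam, #|Exc p.1| = j
    & compatible p.1 p.2]].

Definition subst_cycle n (sigma : 'S_n) (s : n.-tuple nat) (c : seq 'I_n) :
    seq letter :=
  [seq (tnth s i, i < sigma i) | i <- c].

Definition phi n (p : 'S_n * n.-tuple nat) : {mset cword} :=
  seq_mset [seq cword_of (subst_cycle p.1 p.2 c) | c <- cycle_form p.1].

(* [phi] may be computed from any way of writing sigma in cycle form. *)
Definition is_cycle_form n (sigma : 'S_n) (cs : seq (seq 'I_n)) : bool :=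
  [&& all (fun c => (c != [::]) && fcycle sigma c) cs
    & perm_eq (flatten cs) (enum 'I_n)].

Lemma cycle_form_spec n (sigma : 'S_n) : is_cycle_form sigma (cycle_form sigma).
Proof.
have injs : injective sigma := @perm_inj _ sigma.
have syms := fconnect_sym injs.
apply/andP; split.
  apply/allP=> _ /mapP[x _ ->]; rewrite cycle_orbit // andbT.
  by rewrite -size_eq0 size_orbit -lt0n order_gt0.
apply: uniq_perm; rewrite ?enum_uniq //; last first.
  move=> x; rewrite mem_enum inE; apply/flattenP.
  exists (orbit sigma (froot sigma x)); last first.
    by rewrite -fconnect_orbit syms connect_root.
  by apply/map_f; rewrite mem_enum; apply: roots_root.
rewrite /cycle_form.
have : all (froots sigma) (enum (froots sigma)).
  by apply/allP=> x; rewrite mem_enum.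
elim: (enum _) (enum_uniq (froots sigma)) => //= x r IHr.
case/andP=> xr ur /andP[rx allr]; rewrite cat_uniq orbit_uniq IHr // andbT /=.
apply/hasPn=> y /flattenP[_ /mapP[z zr ->]].
rewrite -fconnect_orbit => zy; apply/negP; rewrite -fconnect_orbit => xy.
have /eqP rz := allP allr _ zr; move/eqP: rx => rx.
have xz : fconnect sigma x z by rewrite (connect_trans xy) // syms.
by move/(rootP syms): xz; rewrite rx rz => exz; rewrite exz zr in xr.
Qed.

Lemma cycle_form_unique n (sigma : 'S_n) (cs : seq (seq 'I_n)) (T : eqType)
    (F : seq 'I_n -> T) : is_cycle_form sigma cs ->
    (forall i c, F (rot i c) = F c) ->
  perm_eq [seq F c | c <- cs] [seq F c | c <- cycle_form sigma].
Proof.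
have injs : injective sigma := @perm_inj _ sigma.
have syms := fconnect_sym injs.
case/andP=> cyc_cs pcs FR.
have ucs : uniq (flatten cs) by rewrite (perm_uniq pcs) enum_uniq.
have [rs [Ers urs mem_rs]] : exists rs : seq 'I_n,
    [/\ [seq F c | c <- cs] = [seq F (orbit sigma x) | x <- rs], uniq rs
      & forall x, (x \in rs) = (x \in froots sigma) && (x \in flatten cs)].
  move: cyc_cs ucs {pcs}; elim: cs => [|c cs IH] /=.
    by exists [::]; split=> // x; rewrite andbF.
  case/andP=> /andP[c0 cyc_c] /IH{}IH; rewrite cat_uniq.
  case/and3P=> uc dis /IH[rs [Ers urs mem_rs]].
  case: c c0 cyc_c uc dis => // x0 c _ cyc_c uc dis.
  set y := froot sigma x0.
  have memc z : (z \in x0 :: c) = fconnect sigma x0 z.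
    by rewrite (fconnect_cycle cyc_c) ?mem_head.
  have yc : y \in x0 :: c by rewrite memc connect_root.
  exists (y :: rs); split.
  - by case: (orbit_rot_cycle cyc_c uc yc) => i /= ->; rewrite FR Ers.
  - rewrite /= urs andbT mem_rs; apply/nandP; right.
    by apply: contraL yc => ycs; apply: (hasPn dis).
  move=> z; rewrite in_cons mem_rs mem_cat andb_orr; congr (_ || _).
  rewrite memc; apply/eqP/andP => [->|[/eqP rz /(rootP syms) xz]].
    by split; [apply: roots_root | apply: connect_root].
  by rewrite /y xz rz.
rewrite Ers -map_comp; apply: perm_map; apply: uniq_perm; rewrite ?enum_uniq //.
by move=> x; rewrite mem_rs (perm_mem pcs) !mem_enum andbT.
Qed.

Lemma cycle_type_cycle_form n (sigma : 'S_n) (cs : seq (seq 'I_n)) :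
  is_cycle_form sigma cs -> cycle_type sigma = sort geq (shape cs).
Proof.
move=> /cycle_form_unique H; apply/perm_sortP.
- by move=> a b; apply: leq_total.
- by move=> b a c ab bc; apply: leq_trans bc ab.
- by move=> a b; rewrite andbC -eqn_leq => /eqP.
by rewrite perm_sym; apply: (H _ size) => i c; rewrite size_rot.
Qed.

Lemma phi_cycle_form n (sigma : 'S_n) (s : n.-tuple nat)
    (cs : seq (seq 'I_n)) : is_cycle_form sigma cs ->
  phi (sigma, s) = seq_mset [seq cword_of (subst_cycle sigma s c) | c <- cs].
Proof.
move=> /cycle_form_unique H; apply/eq_seq_msetP; rewrite perm_sym.
apply: (H _ (fun c => cword_of (subst_cycle sigma s c))) => i c.
by apply/esym/eqP/cword_ofP; exists i; rewrite /subst_cycle map_rot.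
Qed.

(* Main.v *)
(* Number the positions of an ornament in decreasing lexicographic order of the
   infinite words read clockwise from them, for 1 < bar 1 < 2 < bar 2 < ...
   Compatibility of (sigma, s) says exactly that 1, ..., n is such a numbering,
   where sigma is increasing on positions with equal words.  Hence two positions
   of one cycle never carry equal words (primitivity), and the multiset of the
   words determines s, and then sigma.  Conversely, number the positions of an
   ornament this way, ordering positions with equal words by their cycles.  The
   necklace condition makes the word read from a barred position greater than
   the next one, and the word read from an unbarred position at most the next
   one, so that the bars mark the excedances. *)
Require Import Defs.
From mathcomp Require Import all_boot all_order perm.
From mathcomp Require Import finmap multiset.
From mathcomp Require Import classical_sets functions.

Set Implicit Arguments.
Unset Strict Implicit.
Unset Printing Implicit Defensive.

Import Order.TTheory.

Local Open Scope nat_scope.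
Local Open Scope mset_scope.

(** * Letter codes and periodic readings along a permutation *)

(* The order of codes is 1 < bar 1 < 2 < bar 2 < ... *)
Definition code (a : letter) : nat := a.1.*2 + a.2.

Lemma odd_code a : odd (code a) = a.2.
Proof. by rewrite /code oddD odd_double; case: a.2. Qed.

Lemma half_code a : (code a)./2 = a.1.
Proof. by rewrite /code addnC half_bit_double. Qed.

Lemma code_inj : injective code.
Proof.
move=> a b e; move: (congr1 odd e) (congr1 half e).
by rewrite !odd_code !half_code; case: a b {e} => [a x] [b y] /= -> ->.
Qed.

(** At equal absolute values a bar adds one to the code, so a barred letter still dominates its
    successor and an unbarred one is still dominated. *)
Lemma step_ok_code a b :
  step_ok a b -> if odd (code a) then code b <= code a else code a <= code b.
Proof.
rewrite odd_code /step_ok /code; case: a b => [a []] [b y] /= ab.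
  by rewrite leq_add ?leq_double //; case: y.
by rewrite addn0 (leq_trans _ (leq_addr _ _)) ?leq_double.
Qed.

(** The type [seqlexi nat] makes the order on readings lexicographic. *)
Definition reading n (sigma : 'S_n) (L : 'I_n -> nat) m x : seqlexi nat :=
  [seq L y | y <- traject sigma x m].

Lemma readingS n (sigma : 'S_n) L m x :
  reading sigma L m.+1 x = L x :: reading sigma L m (sigma x).
Proof. by []. Qed.

Lemma iter_order_mul (T : finType) (f : T -> T) (injf : injective f) k x :
  iter (k * order f x) f x = x.
Proof. by elim: k => // k IHk; rewrite mulSn addnC iterD iter_order. Qed.

Lemma dvdn_order_fact n (sigma : 'S_n) x : order sigma x %| n`!.
Proof.
by rewrite dvdn_fact // order_gt0 -[X in _ <= X](card_ord n) max_card.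
Qed.

Lemma iter_fact n (sigma : 'S_n) x : iter n`! sigma x = x.
Proof.
have /dvdnP[k ->] := dvdn_order_fact sigma x.
by rewrite iter_order_mul //; apply: perm_inj.
Qed.

(* [n`!] is a common period of all readings, so this finite word determines
   the infinite word read from [x]. *)
Definition period_reading n (sigma : 'S_n) L := reading sigma L n`!.

Lemma period_readingE n (sigma : 'S_n) L x :
  period_reading sigma L x = L x :: reading sigma L n`!.-1 (sigma x).
Proof. by rewrite /period_reading -[in LHS](prednK (fact_gt0 n)). Qed.

(** A full period of steps leads back to [x], so the letter dropped in front reappears at the
    end. *)
Lemma period_reading_perm n (sigma : 'S_n) L x :
  period_reading sigma L (sigma x) = rot 1 (period_reading sigma L x).
Proof.
rewrite [in RHS]period_readingE rot1_cons /period_reading /reading.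
rewrite -[in LHS](prednK (fact_gt0 n)) trajectSr map_rcons -iterSr.
by rewrite prednK ?fact_gt0 // iter_fact.
Qed.

Lemma period_reading_perm_inj n (sigma : 'S_n) L x y :
  (period_reading sigma L (sigma x) == period_reading sigma L (sigma y)) =
  (period_reading sigma L x == period_reading sigma L y).
Proof. by rewrite !period_reading_perm; apply/inj_eq/rot_inj. Qed.

Lemma period_reading_head n (sigma : 'S_n) L L' (sigma' : 'S_n) x y :
  period_reading sigma L x = period_reading sigma' L' y -> L x = L' y.
Proof. by rewrite !period_readingE => -[]. Qed.

(** * Standard labellings and their readings *)

(** Only single letters and one step of [sigma] are compared here; [standard_reading] extends the
    comparison to whole readings. *)
Definition standard n (sigma : 'S_n) (L : 'I_n -> nat) :=
  forall i k : 'I_n, i < k -> L k <= L i /\ (L i = L k -> sigma i < sigma k).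

(** When the first letters tie, [sigma] keeps the order of [i] and [k], so the tails compare by
    induction. *)
Lemma standard_reading n (sigma : 'S_n) L m (i k : 'I_n) :
  standard sigma L -> i < k -> (reading sigma L m k <= reading sigma L m i)%O.
Proof.
move=> std; elim: m i k => // m IHm i k ik.
have [le_ki eq_ik] := std _ _ ik.
rewrite !readingS lexi_cons !leEnat le_ki /=; apply/implyP=> le_ik.
by apply/IHm/eq_ik/eqP; rewrite eqn_leq le_ik.
Qed.

Lemma standard_reading_eq n (sigma : 'S_n) L (i k : 'I_n) :
  standard sigma L -> i < k ->
  period_reading sigma L i = period_reading sigma L k -> sigma i < sigma k.
Proof. by move=> std ik /period_reading_head; apply: (std _ _ ik).2. Qed.

Lemma standard_reading_iter n (sigma : 'S_n) L (i k : 'I_n) r :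
  standard sigma L -> i < k ->
  period_reading sigma L i = period_reading sigma L k ->
  iter r sigma i < iter r sigma k /\
  period_reading sigma L (iter r sigma i) =
  period_reading sigma L (iter r sigma k).
Proof.
move=> std ik eik; elim: r => //= r [lt_r eq_r]; split.
  exact: standard_reading_eq eq_r.
by apply/eqP; rewrite period_reading_perm_inj eq_r.
Qed.

(** Suppose [x < y] have equal readings and [y] is reached from [x] in [r] steps. Repeating these
    [r] steps then gives an endless strictly increasing sequence of positions, impossible in
    ['I_n]. *)
Lemma standard_inj_orbit n (sigma : 'S_n) L (i k : 'I_n) :
  standard sigma L -> fconnect sigma i k ->
  period_reading sigma L i = period_reading sigma L k -> i = k.
Proof.
move=> std.
have no_lt (x y : 'I_n) : fconnect sigma x y ->
    period_reading sigma L x = period_reading sigma L y -> ~ x < y.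
  move=> /iter_findex; set r := findex _ _ _ => def_y exy xy.
  have incr m : period_reading sigma L (iter m (iter r sigma) x) =
      period_reading sigma L (iter m.+1 (iter r sigma) x) /\
      iter m (iter r sigma) x < iter m.+1 (iter r sigma) x.
    elim: m => [|m [em lm]]; first by rewrite /= def_y.
    rewrite iterS [in X in _ = X]iterS.
    by have [] := standard_reading_iter r std lm em.
  have grow m : m <= iter m (iter r sigma) x.
    by elim: m => // m IHm; apply: leq_ltn_trans IHm (incr m).2.
  (* After [n] rounds the position would be at least [n]. *)
  by have := leq_ltn_trans (grow n) (ltn_ord _); rewrite ltnn.
have symc := fconnect_sym (@perm_inj _ sigma).
move=> cik eik; have [ik|ki|/val_inj//] := ltngtP i k.
  by case: (no_lt _ _ cik eik).
by rewrite symc in cik; case: (no_lt _ _ cik (esym eik)).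
Qed.

(** * Rotations of words and primitivity *)

Definition rots (T : Type) (u : seq T) := [seq rot i u | i <- iota 0 (size u)].

Lemma map_rots (T T' : Type) (f : T -> T') u :
  [seq [seq f x | x <- v] | v <- rots u] = rots [seq f x | x <- u].
Proof.
by rewrite /rots size_map -map_comp; apply: eq_map => i /=; rewrite map_rot.
Qed.

Lemma rots_rot (T : Type) k (u : seq T) :
  k <= size u -> rots (rot k u) = rot k (rots u).
Proof.
elim: k => [|k IHk] ku; first by rewrite !rot0.
rewrite (rotS ku) (rotS (s := rots u)) ?size_map ?size_iota //.
rewrite -{}IHk ?(ltnW ku) //.
move: (rot k u) (size_rot k u) ku => v <- lt_kv.
have [m sv] : exists m, size v = m.+1.
  by exists (size v).-1; rewrite prednK // (leq_trans _ lt_kv).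
have iota_rcons : iota 0 m.+1 = iota 0 m ++ [:: m].
  by rewrite -addn1 iotaD.
rewrite /rots size_rot sv [in LHS]iota_rcons map_cat /= rot1_cons -cats1.
congr (_ ++ [:: _]).
  rewrite -[1]addn0 iotaDl -map_comp.
  apply/eq_in_map => i; rewrite mem_iota add0n => /andP[_ im] /=.
  by rewrite -[1 + 0]/1 addnC rotD ?sv ?addn1 // ltnW.
(* The last rotation of [rot 1 v] is a full turn of [v], that is [v] itself. *)
by rewrite rot0 -rotD ?sv ?addn1 // -sv rot_size.
Qed.

Lemma perm_rots_repr u : perm_eq (rots (repr (cword_of u))) (rots u).
Proof.
have [i ->] := repr_cword_of u; have [le_i|/ltnW lt_i] := leqP i (size u).
  by rewrite rots_rot // perm_rot.
by rewrite rot_oversize.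
Qed.

Lemma map_index_uniq (T : eqType) (p : seq T) :
  uniq p -> [seq index x p | x <- p] = iota 0 (size p).
Proof.
case: p => // x0 p up.
apply: (@eq_from_nth _ 0); rewrite !size_map ?size_iota // => i lt_i.
by rewrite (nth_map x0) // nth_iota // index_uniq.
Qed.

(** Starting positions in the word [p] become points of the cycle: the rotation that brings [x] to
    the front is the orbit of [x]. *)
Lemma rots_cycle (T : finType) (f : T -> T) p :
  fcycle f p -> uniq p -> rots p = [seq orbit f x | x <- p].
Proof.
move=> fp up; rewrite /rots -map_index_uniq // -map_comp.
by apply/eq_in_map => x px; rewrite /= (orbitE fp).
Qed.

(** This reading refers to a word alone, with no permutation, so it can be taken from an
    ornament. *)
Definition cyclic_reading m (u : seq nat) : seqlexi nat :=
  mkseq (fun t => nth 0 u (t %% size u)) m.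

Lemma period_reading_orbit n (sigma : 'S_n) L x :
  period_reading sigma L x = cyclic_reading n`! [seq L y | y <- orbit sigma x].
Proof.
have sz : size (traject sigma x n`!) = n`! by rewrite size_traject.
apply: (@eq_from_nth _ 0); rewrite size_map sz ?size_mkseq // => i lt_i.
have lt_io : i %% order sigma x < order sigma x by rewrite ltn_mod order_gt0.
rewrite (nth_map x) ?sz // nth_mkseq // size_map size_orbit.
rewrite (nth_map x) ?size_orbit // /orbit !nth_traject //.
rewrite [in LHS](divn_eq i (order sigma x)).
by rewrite addnC iterD iter_order_mul //; apply: perm_inj.
Qed.

Lemma orbit_period_reading n (sigma : 'S_n) L x :
  [seq L y | y <- orbit sigma x] =
  take (order sigma x) (period_reading sigma L x).
Proof.
have le_o : order sigma x <= n`! by rewrite dvdn_leq ?fact_gt0 ?dvdn_order_fact.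
rewrite /period_reading /reading -map_take -(subnKC le_o) trajectD.
by rewrite take_size_cat ?size_traject.
Qed.

(** All orbits started on one cycle have the same length, so truncating equal readings to that
    length gives equal finite words. *)
Lemma eq_period_reading n (sigma : 'S_n) L p :
  fcycle sigma p -> uniq p -> {in p &, forall x y,
  (period_reading sigma L x == period_reading sigma L y) =
  ([seq L z | z <- orbit sigma x] == [seq L z | z <- orbit sigma y])}.
Proof.
move=> sp up x y px py; apply/eqP/eqP => [e|].
  by rewrite !orbit_period_reading e !(order_cycle sp up).
by rewrite !period_reading_orbit => ->.
Qed.

Lemma uniq_map_inj (T T' : eqType) (f : T -> T') p :
  uniq [seq f x | x <- p] -> {in p &, injective f}.
Proof.
elim: p => //= a p IHp /andP[fa up] x y; rewrite !inE.
case/predU1P=> [->|px] /predU1P[->|py] // e; last exact: IHp e.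
- by rewrite e map_f in fa.
- by rewrite -e map_f in fa.
Qed.

Lemma primitive_cycle n (sigma : 'S_n) (w : 'I_n -> letter) p :
  fcycle sigma p -> uniq p -> primitive_word [seq w x | x <- p] <->
  {in p &, injective (period_reading sigma (code \o w))}.
Proof.
move=> sp up; rewrite /primitive_word -/(rots _) -map_rots.
rewrite (rots_cycle sp up) -map_comp.
rewrite -(map_inj_uniq (inj_map code_inj)) -map_comp.
have eqW : {in p &, forall x y,
    (period_reading sigma (code \o w) x ==
     period_reading sigma (code \o w) y) =
    ([seq code i | i <- [seq w i | i <- orbit sigma x]] ==
     [seq code i | i <- [seq w i | i <- orbit sigma y]])}.
  by move=> x y px py; rewrite (eq_period_reading _ sp up) // -!map_comp.
split=> [/uniq_map_inj inj x y px py /eqP|inj].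
  by rewrite eqW // => /eqP; apply: inj.
rewrite map_inj_in_uniq // => x y px py /eqP; rewrite -eqW // => /eqP.
exact: inj.
Qed.

(** * Compatibility as standardness of the coded labels *)

Lemma in_Exc n (sigma : 'S_n) i : (i \in Exc sigma) = (i < sigma i).
Proof.
rewrite inE andbC; case: ltnP => //= lt_i.
by apply: leq_ltn_trans lt_i _.
Qed.

Definition barred n (sigma : 'S_n) (s : n.-tuple nat) (i : 'I_n) : letter :=
  (tnth s i, i < sigma i).

Lemma compatible_standard n (sigma : 'S_n) (s : n.-tuple nat) :
  compatible sigma s -> standard sigma (code \o barred sigma s).
Proof.
case=> _ le_s lt_s; set L := _ \o _.
(* Consecutive positions come first; the general case follows by induction on the gap. *)
have step (i k : 'I_n) : k = i.+1 :> nat ->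
    L k <= L i /\ (L i = L k -> sigma i < sigma k).
  move=> ki; have := le_s _ _ ki; rewrite leq_eqVlt => /predU1P[eq_s|{}lt_s].
    have : i \notin Exd sigma.
      by apply/negP => /(lt_s _ _ ki); rewrite eq_s ltnn.
    rewrite inE => /existsP not_lt.
    have {not_lt}: ~~ ltr_lt (bar_perm sigma k) (bar_perm sigma i).
      by apply/negP => lt; apply: not_lt; exists k; rewrite ki eqxx.
    rewrite /ltr_lt /bar_perm /= !in_Exc ltnS negb_or => /andP[bars lt_sigma].
    rewrite /L /code /= eq_s leq_add2l; split.
      by case: (k < _) (i < _) bars => [] [].
    move/addnI => e; have {}e : (i < sigma i) = (k < sigma k).
      by case: (i < _) (k < _) e => [] [].
    (* With equal bars, the absence of a descent gives a weak inequality between the images;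
       injectivity of [sigma] makes it strict. *)
    rewrite e eqxx /= -leqNgt leq_eqVlt in lt_sigma.
    case/predU1P: lt_sigma => // /val_inj /perm_inj e'.
    by move/eqP: ki; rewrite e' ltn_eqF.
  (* A drop in [s] changes the code by at least two before bars, which outweighs any bar. *)
  have lt_L : L k < L i.
    rewrite /L /code /= (@leq_trans (tnth s i).*2) ?leq_addr //.
    rewrite (leq_trans _ (_ : (tnth s k).+1.*2 <= _)) ?leq_double //.
    by rewrite doubleS; case: (k < _); rewrite ?addn1 ?addn0 ltnS.
  by split; [apply: ltnW | move=> e; rewrite e ltnn in lt_L].
move=> i k ik; have [d def_k] : exists d, k = i + d.+1 :> nat.
  by exists (k - i.+1); rewrite addnS -addSn subnKC.
elim: d i {ik} def_k => [|d IHd] i def_k.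
  by apply: step; rewrite def_k addn1.
have lt_i : i.+1 < n.
  by apply: leq_ltn_trans (ltn_ord k); rewrite def_k addnS ltnS leq_addr.
have [le1 eq1] := step i (Ordinal lt_i) erefl.
have [|le2 eq2] := IHd (Ordinal lt_i); first by rewrite /= addSnnS.
split; first exact: leq_trans le2 le1.
(* Labels decrease weakly, so equal labels at the ends force equal labels in between. *)
move=> e; have e1 : L i = L (Ordinal lt_i).
  by apply/eqP; rewrite eqn_leq le1 e le2.
exact: ltn_trans (eq1 e1) (eq2 (etrans (esym e1) e)).
Qed.

(** If [s] were constant across a descent, either a bar would appear at [k] and raise the code, or
    equal bars would tie the codes while the images decrease; both contradict standardness. *)
Lemma standard_compatible n (sigma : 'S_n) (s : n.-tuple nat) :
  (forall i, 0 < tnth s i) ->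
  standard sigma (code \o barred sigma s) -> compatible sigma s.
Proof.
move=> s_gt0 std.
have le_s (i k : 'I_n) : k = i.+1 :> nat -> tnth s k <= tnth s i.
  move=> ki; have [|le_L _] := std i k; first by rewrite ki.
  by move: (half_leq le_L); rewrite !half_code.
split=> // i k ki iExd; rewrite ltn_neqAle le_s // andbT.
apply/eqP => eq_s; have [|] := std i k; first by rewrite ki.
move: iExd; rewrite inE => /existsP[k' /andP[/eqP k'i]].
have -> : k' = k by apply: val_inj; rewrite /= k'i.
rewrite /ltr_lt /bar_perm /= !in_Exc /code /= eq_s leq_add2l ltnS.
case: (k < sigma k) (i < sigma i) => [] [] //=; rewrite ?andbF //= => lt_sigma;
  by move=> _ /(_ erefl); rewrite ltnNge (ltnW lt_sigma).
Qed.

(** * Images of [phi] are ornaments *)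

Lemma phiE n (sigma : 'S_n) (s : n.-tuple nat) :
  perm_eq (phi (sigma, s))
    [seq cword_of [seq barred sigma s i | i <- c] | c <- cycle_form sigma].
Proof. exact: perm_eq_seq_mset. Qed.

Lemma ornament_type_phi n (sigma : 'S_n) (s : n.-tuple nat) :
  ornament_type (phi (sigma, s)) = cycle_type sigma.
Proof.
rewrite /ornament_type /cycle_type; apply/perm_sortP.
- by move=> a b; apply: leq_total.
- by move=> b a c ab bc; apply: leq_trans bc ab.
- by move=> a b; rewrite andbC -eqn_leq => /eqP.
apply: perm_trans (perm_map _ (phiE sigma s)) _.
rewrite -map_comp (_ : [seq _ | c <- _] = shape (cycle_form sigma)) //.
by apply: eq_map => c /=; rewrite cw_size_of size_map.
Qed.

Lemma sumn_bars_phi n (sigma : 'S_n) (s : n.-tuple nat) :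
  sumn [seq cw_bars w | w <- phi (sigma, s)] = #|Exc sigma|.
Proof.
rewrite (perm_sumn (perm_map _ (phiE sigma s))) -map_comp.
rewrite (_ : map _ _ = map (count (mem (Exc sigma))) (cycle_form sigma)).
  have /andP[_ pcf] := cycle_form_spec sigma.
  by rewrite -count_flatten (seq.permP pcf) enumT cardE size_filter.
apply: eq_map => c; rewrite /= cw_bars_of /nbars count_map.
by apply: eq_count => i; rewrite /= in_Exc.
Qed.

Lemma phi_necklace n (sigma : 'S_n) (s : n.-tuple nat) w :
  compatible sigma s -> w \in phi (sigma, s) -> is_necklace w.
Proof.
move=> comp; have std := compatible_standard comp; case: comp => s_gt0 le_s _.
have {le_s} le_s (i k : 'I_n) : i <= k -> tnth s k <= tnth s i.
  rewrite leq_eqVlt => /predU1P[/val_inj->//|/std[le_L _]].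
  by move: (half_leq le_L); rewrite !half_code.
move=> win.
have : w \in (phi (sigma, s) : seq _) by [].
rewrite (perm_mem (phiE sigma s)) => /mapP[c /mapP[x _ ->] ->].
have injs := @perm_inj _ sigma.
have cyc := cycle_orbit injs x; have unic := orbit_uniq sigma x.
rewrite is_necklace_of /is_necklace_word size_map size_orbit order_gt0 /=.
apply/and3P; split.
- by apply/allP => _ /mapP[i _ ->]; apply: s_gt0.
- apply/(primitive_cycle _ cyc unic) => i k ci ck.
  apply: standard_inj_orbit => //.
  by rewrite (fconnect_cycle cyc ci).
have [ord1|_] := eqVneq.
  (* A cycle of length one is a fixed point, hence not an excedance. *)
  apply/allP => _ /mapP[i xi ->]; rewrite /= -leqNgt.
  suff -> : sigma i = i by [].
  have := iter_order injs i; rewrite (eq_order_cycle cyc (in_orbit _ x) xi).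
  by rewrite ord1.
(* As [s] decreases weakly, an excedance is followed by a letter that is no larger, any other
   position by one that is no smaller. *)
rewrite cycle_map; apply: sub_cycle cyc => i _ /= /eqP <-; rewrite /step_ok /=.
by case: ltnP => [/ltnW|]; apply: le_s.
Qed.

(** * Recovering a compatible pair from its image *)

Definition cword_readings m (w : cword) : seq (seqlexi nat) :=
  [seq cyclic_reading m [seq code a | a <- v] | v <- rots (repr w)].

Lemma perm_flatten_map (T : Type) (T' : eqType) (f g : T -> seq T') r :
  (forall x, perm_eq (f x) (g x)) ->
  perm_eq (flatten [seq f x | x <- r]) (flatten [seq g x | x <- r]).
Proof. by move=> fg; elim: r => //= x r; apply: perm_cat. Qed.

(** The right-hand side depends on the ornament alone, so pairs with equal images have the same
    multiset of readings. *)
Lemma perm_phi_readings n (sigma : 'S_n) (s : n.-tuple nat) :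
  perm_eq
    [seq period_reading sigma (code \o barred sigma s) i | i <- enum 'I_n]
    (flatten [seq cword_readings n`! w | w <- phi (sigma, s)]).
Proof.
have injs := @perm_inj _ sigma; have /andP[_ pcf] := cycle_form_spec sigma.
rewrite perm_sym (perm_trans (perm_flatten (perm_map _ (phiE _ _)))) //.
set W := period_reading _ _; rewrite perm_sym.
have := perm_map W pcf; rewrite perm_sym => /perm_trans->//.
rewrite map_flatten /cycle_form -!map_comp; apply: perm_flatten_map => x /=.
rewrite perm_sym (perm_trans (perm_map _ (perm_rots_repr _))) // -map_rots.
rewrite (rots_cycle (cycle_orbit injs x) (orbit_uniq _ _)) -!map_comp.
rewrite (_ : map _ _ = [seq W i | i <- orbit sigma x]) //.
by apply: eq_map => i /=; rewrite /W period_reading_orbit -map_comp.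
Qed.

Lemma sorted_map_enum_ord n (T : Type) (r : rel T) (f : 'I_n -> T) :
  (forall i k : 'I_n, i < k -> r (f i) (f k)) ->
  sorted r [seq f i | i <- enum 'I_n].
Proof.
move=> rf; rewrite sorted_map.
apply: (@sub_sorted _ (relpre val ltn)) => [i k|]; first exact: rf.
by rewrite -sorted_map val_enum_ord iota_ltn_sorted.
Qed.

(** Both lists of readings are weakly decreasing, and a multiset has only one such arrangement. *)
Lemma standard_eq_reading n (sigma sigma' : 'S_n) L L' :
  standard sigma L -> standard sigma' L' ->
  perm_eq [seq period_reading sigma L i | i <- enum 'I_n]
          [seq period_reading sigma' L' i | i <- enum 'I_n] ->
  period_reading sigma L =1 period_reading sigma' L'.
Proof.
move=> std std' peq i.
have sortW tau M : standard tau M ->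
    sorted >=%O [seq period_reading tau M i | i <- enum 'I_n].
  by move=> stdM; apply: sorted_map_enum_ord => j k jk; apply: standard_reading.
have /eq_in_map/(_ i) :=
  sorted_eq ge_trans ge_anti (sortW _ _ std) (sortW _ _ std') peq.
by apply; rewrite mem_enum.
Qed.

(** This recovers [sigma i] as a rank, from comparisons between images only. *)
Lemma card_perm_lt n (sigma : 'S_n) i :
  #|[set k | sigma k < sigma i]| = sigma i.
Proof.
have -> : [set k | sigma k < sigma i] =
    sigma @^-1: [set k : 'I_n | k < sigma i].
  by apply/setP => k; rewrite !inE.
rewrite card_preimset; last exact: perm_inj.
rewrite -sum1dep_card (big_ord_narrow (ltnW (ltn_ord (sigma i)))).
by rewrite sum1_card card_ord.
Qed.

(* The right-hand side mentions sigma only through the readings [W]. *)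
Lemma standard_ltE n (sigma : 'S_n) L (i k : 'I_n) : standard sigma L ->
  let W := period_reading sigma L in
  (sigma k < sigma i) =
  ((rot 1 (W i) : seqlexi nat) < rot 1 (W k))%O || (W k == W i) && (k < i).
Proof.
move=> std W; rewrite -!period_reading_perm -/(W _) -/(W _).
have leW (j l : 'I_n) : j < l -> (W l <= W j)%O by apply: standard_reading.
rewrite lt_neqAle /W -period_reading_perm_inj -/W [W (sigma k) == _]eq_sym.
(* Images with equal readings keep the order of [i] and [k]; otherwise their readings decide, the
   larger one coming first. *)
have [/eqP|neW] /= := eqVneq (W (sigma i)) (W (sigma k)).
  rewrite period_reading_perm_inj => /eqP eW.
  have [ki|ik|/val_inj->] := ltngtP k i; last by rewrite ltnn.
    exact: standard_reading_eq std ki (esym eW).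
  by rewrite ltnNge ltnW //; apply: standard_reading_eq std ik eW.
rewrite orbF; have [|ik|/val_inj e] := ltngtP (sigma k) (sigma i).
- by move/leW.
- apply/esym/negP => le_ik; case/negP: neW; apply/eqP/le_anti.
  by rewrite le_ik leW.
by rewrite e eqxx in neW.
Qed.

Lemma standard_inj n (sigma sigma' : 'S_n) L L' :
  standard sigma L -> standard sigma' L' ->
  period_reading sigma L =1 period_reading sigma' L' -> sigma = sigma'.
Proof.
move=> std std' eqW; apply/permP => i; apply: val_inj => /=.
rewrite -[LHS]card_perm_lt -[RHS]card_perm_lt; apply: eq_card => k.
by rewrite !inE (standard_ltE _ _ std) (standard_ltE _ _ std') !eqW.
Qed.

Lemma phi_inj n (p p' : 'S_n * n.-tuple nat) :
  compatible p.1 p.2 -> compatible p'.1 p'.2 -> phi p = phi p' -> p = p'.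
Proof.
case: p p' => [sigma s] [sigma' s'] /= /compatible_standard std.
move=> /compatible_standard std' eq_phi.
have eqW : period_reading sigma (code \o barred sigma s) =1
           period_reading sigma' (code \o barred sigma' s').
  apply: standard_eq_reading => //; apply: perm_trans (perm_phi_readings _ _) _.
  by rewrite eq_phi perm_sym perm_phi_readings.
congr (_, _); first exact: standard_inj eqW.
apply: eq_from_tnth => i; have /code_inj[] := period_reading_head (eqW i).
by [].
Qed.

(** * Permutations with prescribed cycles or prescribed order *)

Lemma exists_perm_cycles (T : finType) (cs : seq (seq T)) :
  perm_eq (flatten cs) (enum T) ->
  exists sigma : {perm T}, all (fun c => fcycle sigma c) cs.
Proof.
move=> pcs; have ucs : uniq (flatten cs) by rewrite (perm_uniq pcs) enum_uniq.
have [f fcs] : exists f : T -> T, all (fun c => fcycle f c) cs.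
  elim: cs ucs {pcs} => [|c cs IHcs]; first by exists id.
  rewrite /= cat_uniq => /and3P[uc dis /IHcs[f fcs]].
  exists (fun x => if x \in c then next c x else f x); apply/andP; split.
    rewrite (eq_in_cycle (P := mem c) (e' := frel (next c))) ?cycle_next //.
    by move=> x y cx _ /=; rewrite [x \in c]cx.
  apply/allP => d csd; have := allP fcs _ csd.
  rewrite (eq_in_cycle (P := mem d) (e' := frel f)) //.
  move=> x y dx _ /=; case: ifP => // cx.
  by case/hasP: dis; exists x => //; apply/flattenP; exists d.
(* A surjective self-map of a finite type is injective, and predecessors within the cycles give
   surjectivity. *)
have surjf y : exists x, f x = y.
  have : y \in flatten cs by rewrite (perm_mem pcs) mem_enum.
  case/flattenP => c csc cy; exists (prev c y).
  exact/eqP/(prev_cycle (allP fcs _ csc)).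
have [g gK] := fin_all_exists surjf.
have injf : injective f by apply: can_inj (canF_sym gK).
exists (perm injf); apply/allP => c /(allP fcs).
by rewrite (eq_fcycle (permE injf)).
Qed.

Lemma exists_perm_words n (us : seq (seq letter)) :
  sumn (shape us) = n -> all (fun u => u != [::]) us ->
  exists (sigma : 'S_n) (w : 'I_n -> letter) (cs : seq (seq 'I_n)),
    is_cycle_form sigma cs /\ [seq [seq w i | i <- c] | c <- cs] = us.
Proof.
(* The letters of all words are numbered consecutively, and the numbers are cut into blocks of the
   lengths of the words. *)
move=> def_n us0; pose cs := reshape (shape us) (enum 'I_n).
pose w (i : 'I_n) := nth (0, false) (flatten us) i.
have sz_enum : size (enum 'I_n) = sumn (shape us) by rewrite size_enum_ord.
have flat_cs : flatten cs = enum 'I_n by rewrite reshapeKr ?sz_enum.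
have wcs : [seq [seq w i | i <- c] | c <- cs] = us.
  rewrite map_reshape -[RHS]flattenK; congr reshape.
  apply: (@eq_from_nth _ (0, false)); rewrite size_map size_enum_ord.
    by rewrite size_flatten.
  move=> i lt_in; rewrite (nth_map (Ordinal lt_in)) ?size_enum_ord //.
  by rewrite /w nth_enum_ord.
have [|sigma cyc] := @exists_perm_cycles _ cs; first by rewrite flat_cs.
exists sigma, w, cs; split=> //; apply/andP; split; last by rewrite flat_cs.
apply/allP => c csc; rewrite (allP cyc) // andbT.
have /(allP us0) : [seq w i | i <- c] \in us by rewrite -wcs map_f.
by case: c {csc}.
Qed.

(** The rank of [x] is the number of elements below it in the strict total order [r]. *)
Lemma exists_ranking n (r : rel 'I_n) :
  irreflexive r -> transitive r -> (forall x y, x != y -> r x y || r y x) ->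
  exists rho : 'S_n, forall x y, (rho x < rho y) = r x y.
Proof.
move=> irr tr tot; pose below x := [set y | r y x].
have lt_below x : #|below x| < n.
  rewrite -[X in _ < X]card_ord -cardsT proper_card // properT.
  by apply/eqP => /setP/(_ x); rewrite !inE irr.
pose f x := Ordinal (lt_below x).
have mono x y : r x y -> f x < f y.
  move=> rxy; have lt_xy : below x \proper below y.
    apply/properP; split; last by exists x; rewrite inE ?irr.
    by apply/fintype.subsetP => z; rewrite !inE => /tr; apply.
  exact: proper_card.
have injf : injective f.
  move=> x y e; apply/eqP; apply: contraT => /tot /orP[] /mono;
  by rewrite e ltnn.
exists (perm injf) => x y; rewrite !permE.
apply/idP/idP => [lt_f|]; last exact: mono.
have [e|/tot/orP[//|/mono/ltnW]] := eqVneq x y; first by rewrite e ltnn in lt_f.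
by rewrite leqNgt lt_f.
Qed.

(** * Standardizing a labelled permutation *)

Lemma reading_leS n (sigma : 'S_n) L m x y :
  (reading sigma L m.+1 x <= reading sigma L m.+1 y)%O ->
  (reading sigma L m x <= reading sigma L m y)%O.
Proof.
elim: m x y => // m IHm x y.
rewrite (readingS _ _ m.+1) (readingS _ _ m.+1 y) lexi_cons.
case/andP=> le_xy le_s.
rewrite !readingS lexi_cons le_xy /=.
by apply/implyP => le_yx; apply: IHm; rewrite le_yx in le_s.
Qed.

(** Dropping the common first letter also adds a letter at the end; words one letter longer than the
    period serve as the link, via [reading_leS]. *)
Lemma period_reading_lt n (sigma : 'S_n) L x y : L x = L y ->
  (period_reading sigma L x < period_reading sigma L y)%O ->
  (period_reading sigma L (sigma x) < period_reading sigma L (sigma y))%O.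
Proof.
move=> eL; rewrite !ltNge; apply: contra => le_yx; apply: reading_leS.
by rewrite !readingS lexi_cons eL lexx.
Qed.

(** If the first two letters agree they have the same parity, so the induction hypothesis at
    [sigma x] points in the same direction. *)
Lemma reading_step n (sigma : 'S_n) L m x :
  (forall y, if odd (L y) then L (sigma y) <= L y else L y <= L (sigma y)) ->
  if odd (L x) then (reading sigma L m (sigma x) <= reading sigma L m x)%O
  else (reading sigma L m x <= reading sigma L m (sigma x))%O.
Proof.
move=> step; elim: m x => [|m IHm] x; first by rewrite if_same.
move: (step x) (IHm (sigma x)); rewrite !readingS !lexi_cons !leEnat.
case: ifP => oddx le1 IH; rewrite le1 /=; apply/implyP => le2;
  have e : L (sigma x) = L x by apply/eqP; rewrite eqn_leq le1 le2.
- by rewrite e oddx in IH.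
- by rewrite e oddx in IH.
Qed.

Lemma exists_standardization n (sigma : 'S_n) (w : 'I_n -> letter) :
  (forall x, 0 < (w x).1) ->
  (forall x, step_ok (w x) (w (sigma x))) ->
  (forall x, sigma x = x -> ~~ (w x).2) ->
  (forall x y, fconnect sigma x y ->
    period_reading sigma (code \o w) x = period_reading sigma (code \o w) y ->
    x = y) ->
  exists (tau : 'S_n) (s : n.-tuple nat) (rho : 'S_n),
    [/\ compatible tau s, forall x, tau (rho x) = rho (sigma x)
      & forall x, barred tau s (rho x) = w x].
Proof.
move=> w_gt0 step fixw inj; set L := code \o w.
set W := period_reading sigma L in inj.
have injs := @perm_inj _ sigma; have syms := fconnect_sym injs.
pose before x y :=
  (W y < W x)%O || (W x == W y) && (froot sigma x < froot sigma y).
have root_sigma x : froot sigma (sigma x) = froot sigma x.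
  by apply/(rootP syms); rewrite syms fconnect1.
have [x|y x z|x y neq_xy|rho rhoE] := @exists_ranking n before.
- by rewrite /before ltxx eqxx ltnn.
- rewrite /before => /orP[lt_yx|/andP[/eqP-> lt_xy]]
    /orP[lt_zy|/andP[/eqP<- lt_yz]].
  + by rewrite (lt_trans lt_zy).
  + by rewrite lt_yx.
  + by rewrite lt_zy.
  + by rewrite eqxx (ltn_trans lt_xy) ?orbT.
(* Distinct positions on one cycle have distinct readings, so the roots break every tie. *)
- rewrite /before; case: ltgtP => //= eW; rewrite -neq_ltn.
  apply: contra neq_xy => /eqP/val_inj/(rootP syms) cxy.
  by apply/eqP/inj.
(* Conjugation by [rho] carries [sigma] from the original positions to their ranks. *)
pose tau := (rho^-1 * sigma * rho)%g.
have tau_rho x : tau (rho x) = rho (sigma x) by rewrite !permM permK.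
pose s := [tuple (w ((rho^-1)%g i)).1 | i < n].
have barredE x : barred tau s (rho x) = w x.
  (* Since [x] and [sigma x] share a root, [rho x] is an excedance exactly when the reading strictly
     drops from [x] to [sigma x]. *)
  rewrite /barred tnth_mktuple permK tau_rho rhoE /before root_sigma.
  rewrite ltnn andbF orbF.
  rewrite [RHS]surjective_pairing; congr (_, _).
  have stepL y : if odd (L y) then L (sigma y) <= L y else L y <= L (sigma y).
    exact: step_ok_code.
  have := reading_step n`! x stepL; rewrite odd_code -/(period_reading _ _).
  rewrite -!/(period_reading sigma L _) -!/(W _).
  case: ifP => [bar le_W|_ le_W]; last by rewrite ltNge le_W.
  (* Equal readings at [x] and [sigma x] would make [x] a fixed point, which carries no bar. *)
  rewrite lt_neqAle le_W andbT; apply/eqP => eW.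
  suff e : sigma x = x by have := fixw _ e; rewrite bar.
  by apply: inj eW; rewrite syms fconnect1.
have barredL i : (code \o barred tau s) i = L ((rho^-1)%g i).
  by rewrite /= -{1}[i](permKV rho) barredE.
exists tau, s, rho; split=> //; apply: standard_compatible => [i|i k].
  by rewrite tnth_mktuple.
rewrite !barredL -[i](permKV rho) -[k](permKV rho) !permK.
move: ((rho^-1)%g i) ((rho^-1)%g k) => x y.
rewrite !tau_rho !rhoE /before => lt_xy; split.
  have: (W y <= W x)%O by case/orP: lt_xy => [/ltW|/andP[/eqP->]].
  by rewrite /W !period_readingE lexi_cons leEnat => /andP[].
(* With equal first letters, a strict comparison passes to the tails; equal readings remain equal
   and the roots do not change. *)
move=> eL; case/orP: lt_xy => [lt_W|/andP[/eqP eW lt_root]].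
  by rewrite (period_reading_lt (esym eL)).
by rewrite !root_sigma lt_root /W period_reading_perm_inj -/W eW eqxx orbT.
Qed.

Lemma necklace_cycle n (sigma : 'S_n) (w : 'I_n -> letter) c x :
  fcycle sigma c -> uniq c -> x \in c -> is_necklace_word [seq w i | i <- c] ->
  [/\ 0 < (w x).1, step_ok (w x) (w (sigma x)), sigma x = x -> ~~ (w x).2
    & forall y, fconnect sigma x y ->
      period_reading sigma (code \o w) x = period_reading sigma (code \o w) y ->
      x = y].
Proof.
move=> cyc unic cx /and4P[_ pos prim].
have memc y : fconnect sigma x y = (y \in c) by apply: fconnect_cycle.
have sigmac : sigma x \in c by rewrite -memc fconnect1.
have inj y : fconnect sigma x y ->
    period_reading sigma (code \o w) x = period_reading sigma (code \o w) y ->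
    x = y.
  by rewrite memc => cy; have /(primitive_cycle _ cyc unic) := prim; apply.
have pos_x : 0 < (w x).1 by apply: (allP pos); apply: map_f.
rewrite size_map; case: eqP => [sz1 unbarred|sz step].
  have bar_x : ~~ (w x).2 by apply: (allP unbarred); apply: map_f.
  have -> : sigma x = x.
    by case: c sz1 cx sigmac {cyc unic pos prim memc unbarred} => [|a []] //= _;
       rewrite !inE => /eqP-> /eqP.
  (* For words of length one the step condition is automatic: an unbarred letter may follow
     itself. *)
  by split=> //; rewrite /step_ok (negbTE bar_x).
split=> //.
  move: step; rewrite cycle_map => /next_cycle/(_ cx) /=.
  by rewrite -(eqP (next_cycle cyc cx)).
(* A fixed point would reduce the whole cycle to one position, against the length of the word. *)
move=> fix_x; case: sz.
have sub_c : {subset c <= [:: x]}.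
  move=> y; rewrite -memc inE => /iter_findex <-.
  by rewrite iter_fix.
apply/eqP; rewrite eqn_leq (uniq_leq_size unic sub_c) /=.
by case: c cx {cyc unic pos prim memc sigmac step sub_c}.
Qed.

(** * Surjectivity and the bijection *)

Lemma phi_surj n (o : {mset cword}) :
  sumn [seq cw_size w | w <- o] = n -> (forall w, w \in o -> is_necklace w) ->
  exists (sigma : 'S_n) (s : n.-tuple nat),
    compatible sigma s /\ phi (sigma, s) = o.
Proof.
move=> def_n neck; pose us := [seq repr w | w <- o].
have neck_us u : u \in us -> is_necklace_word u by case/mapP=> w /neck ? ->.
have [|| sigma [w [cs [form wcs]]]] := @exists_perm_words n us.
- by rewrite /shape -map_comp.
- by apply/allP => u /neck_us /andP[]; rewrite lt0n size_eq0.
have /andP[cyc pcs] := form.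
have ucs : uniq (flatten cs) by rewrite (perm_uniq pcs) enum_uniq.
have uniqc c : c \in cs -> uniq c.
  move=> csc; case/splitPr: csc ucs {form wcs cyc pcs} => cs1 cs2.
  by rewrite flatten_cat /= !cat_uniq => /and3P[_ _ /andP[]].
have local x : [/\ 0 < (w x).1, step_ok (w x) (w (sigma x)),
    sigma x = x -> ~~ (w x).2 & forall y, fconnect sigma x y ->
      period_reading sigma (code \o w) x = period_reading sigma (code \o w) y ->
      x = y].
  have : x \in flatten cs by rewrite (perm_mem pcs) mem_enum.
  case/flattenP => c csc cx; have /andP[_ cyc_c] := allP cyc _ csc.
  apply: (necklace_cycle cyc_c) => //; first exact: uniqc.
  by apply: neck_us; rewrite -wcs map_f.
have [||||tau [s [rho [comp tau_rho bar]]]] :=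
  @exists_standardization n sigma w; try by move=> x; case: (local x).
exists tau, s; split=> //.
(* Renaming the cycles by [rho] writes [tau] in cycle form with the words in their original order,
   so [phi] can be computed from it. *)
have form' : is_cycle_form tau [seq [seq rho x | x <- c] | c <- cs].
  apply/andP; split.
    apply/allP => _ /mapP[c csc ->]; have /andP[c0 cyc_c] := allP cyc _ csc.
    apply/andP; split; first by case: c c0 {csc cyc_c}.
    rewrite cycle_map; apply: sub_cycle cyc_c => x y /= /eqP <-.
    by rewrite tau_rho.
  rewrite -map_flatten; apply: uniq_perm; rewrite ?enum_uniq //.
    by rewrite map_inj_uniq //; apply: perm_inj.
  move=> y; rewrite mem_enum inE -(permKV rho y) mem_map; last exact: perm_inj.
  by rewrite (perm_mem pcs) mem_enum.
rewrite (phi_cycle_form s form') -[RHS]seq_mset_id -map_comp.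
congr seq_mset; rewrite -[RHS]map_id.
rewrite (_ : [seq id w | w <- o] = [seq cword_of u | u <- us]).
  rewrite -wcs -map_comp; apply: eq_map => c /=; congr cword_of.
  by rewrite /subst_cycle -map_comp; apply: eq_map => x /=; apply: bar.
by rewrite -map_comp; apply: eq_map => v /=; rewrite /cword_of reprK.
Qed.

Theorem theorem3p2 (n : nat) (lam : seq nat) (j : nat) :
  is_partition n lam -> (j < n)%N ->
  set_bij (@Com n lam j) (Orn lam j) (@phi n).
Proof.
move=> /and3P[_ _ /eqP sum_lam] _; split.
- move=> [sigma s] [/= type_lam exc_j comp]; split.
  + by move=> w; apply: phi_necklace.
  + by rewrite ornament_type_phi.
  + by rewrite sumn_bars_phi.
- move=> p p' /set_mem[_ _ comp] /set_mem[_ _ comp']; exact: phi_inj.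
move=> o [neck type_lam bars_j].
have [||sigma [s [comp def_o]]] := @phi_surj n o => //.
  (* The type [lam] sums to [n], which fixes the number of positions. *)
  rewrite -sum_lam -type_lam /ornament_type.
  by rewrite (perm_sumn (permEl (perm_sort _ _))).
exists (sigma, s) => //; split=> //=.
  by rewrite -type_lam -def_o ornament_type_phi.
by rewrite -bars_j -def_o sumn_bars_phi.
Qed.
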